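(* Let $A\in\mathbb{R}^{n\times n}$ be symmetric positive definite, $b\in\mathbb{R}^n$, $1\le p<n$, $X_0\in\mathbb{R}^{n\times p}$, and consider the matrices $X_i,R_i,D_i$ generated by the cooperative Conjugate Gradient (cCG) algorithm started at $X_0$. As long as the matrix $D_k$ is full rank (that is, for every $k\ge 0$ such that the algorithm reaches iteration $k$, so that $D_0,\dots,D_{k-1}$ have rank $p$, and $\operatorname{rank} D_k=p$), the following hold. (i) The matrices $R_0,\dots,R_k$ are mutually orthogonal, i.e. $R_i^{T}R_j=0$ for $0\le i\neq j\le k$; the matrices $D_0,\dots,D_k$ are mutually $A$-orthogonal, i.e. $D_i^{T}AD_j=0$ for $0\le i\ne j\le k$; and the subspaces $\mathrm{span}\,[R_i]_0^k$, $\mathrm{span}\,[D_i]_0^k$ and $\mathrm{span}\,[A^iR_0]_0^k$ of $\mathbb{R}^n$ are equal and have dimension $(k+1)p$. (ii) For any vector $e_j$ of the canonical basis of $\mathbb{R}^p$, the vector $X_{k+1}e_j\in\mathbb{R}^n$ (the $j$-th column of $X_{k+1}$) is the minimizer of $f$ on the affine subspace $X_0e_j+\mathrm{span}\,[D_i]_0^k$.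
   Context: Here $f(x)=\frac12 x^{T}Ax-b^{T}x$ for $x\in\mathbb{R}^n$. $\mathbf 1_p\in\mathbb{R}^p$ denotes the column vector of ones. For matrices $M_0,\dots,M_k\in\mathbb{R}^{n\times p}$, $[M_i]_0^k=[M_0\ M_1\ \cdots\ M_k]\in\mathbb{R}^{n\times(k+1)p}$ is their concatenation and $\mathrm{span}\,[M_i]_0^k=\{[M_i]_0^k\gamma:\gamma\in\mathbb{R}^{(k+1)p}\}$ is its column space. The cCG algorithm (in exact arithmetic): choose $X_0\in\mathbb{R}^{n\times p}$; set $R_0=AX_0-b\mathbf 1_p^{T}$, $D_0=R_0$, $k=0$. While $D_k$ is full rank (rank $p$), set $$\alpha_k=-R_k^{T}D_k(D_k^{T}AD_k)^{-1}\in\mathbb{R}^{p\times p},\qquad X_{k+1}=X_k+D_k\alpha_k^{T},\qquad R_{k+1}=AX_{k+1}-b\mathbf 1_p^{T},$$ $$\beta_k=-R_{k+1}^{T}AD_k(D_k^{T}AD_k)^{-1}\in\mathbb{R}^{p\times p},\qquad D_{k+1}=R_{k+1}+D_k\beta_k^{T},$$ and increase $k$ by one. All of $X_k,R_k,D_k$ are in $\mathbb{R}^{n\times p}$. *)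

(* Defs.v *)
From mathcomp Require Import all_boot all_order all_algebra.
From mathcomp Require Export reals.

Set Implicit Arguments.
Unset Strict Implicit.
Unset Printing Implicit Defensive.

Import GRing.Theory Num.Theory.
Local Open Scope ring_scope.

Definition posdefmx (R : realType) (n : nat) (A : 'M[R]_n) : Prop :=
  forall x : 'cV[R]_n, x != 0 -> 0 < (x^T *m A *m x) 0 0.

Definition quadratic (R : realType) (n : nat) (A : 'M[R]_n) (b : 'cV[R]_n)
    (x : 'cV[R]_n) : R :=
  2^-1 * (x^T *m A *m x) 0 0 - (b^T *m x) 0 0.

Definition minimizer (R : realType) (n : nat) (f : 'cV[R]_n -> R)
    (S : 'cV[R]_n -> Prop) (x : 'cV[R]_n) : Prop :=
  S x /\ forall y, S y -> f x <= f y.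

(* {M *m g | g : 'cV_q}; mxalgebra's (_ <= _)%MS compares row spaces instead. *)
Definition colspan (F : fieldType) (n q : nat) (M : 'M[F]_(n, q)) :
    {vspace 'cV[F]_n} :=
  limg (linfun (mulmx M : 'cV[F]_q -> 'cV[F]_n)).

(* Column space of the concatenation [M 0 M 1 ... M k] (k.+1 blocks). *)
Definition block_span (F : fieldType) (n p : nat) (M : nat -> 'M[F]_(n, p))
    (k : nat) : {vspace 'cV[F]_n} :=
  colspan (\mxrow_(i < k.+1) M i).

Section CooperativeCG.

Variables (F : fieldType) (n p : nat) (A : 'M[F]_n) (b : 'cV[F]_n).

Definition residual (X : 'M[F]_(n, p)) : 'M[F]_(n, p) :=
  A *m X - b *m (const_mx 1 : 'cV[F]_p)^T.

Definition cCG_alpha (R D : 'M[F]_(n, p)) : 'M[F]_p :=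
  - (R^T *m D *m invmx (D^T *m A *m D)).

Definition cCG_beta (R' D : 'M[F]_(n, p)) : 'M[F]_p :=
  - (R'^T *m A *m D *m invmx (D^T *m A *m D)).

Definition cCG_step (XD : 'M[F]_(n, p) * 'M[F]_(n, p)) :
    'M[F]_(n, p) * 'M[F]_(n, p) :=
  let: (X, D) := XD in
  let X' := X + D *m (cCG_alpha (residual X) D)^T in
  let R' := residual X' in
  (X', R' + D *m (cCG_beta R' D)^T).

(* The recursion is total; the stopping test is [cCG_reaches] below, and the
   values after a rank-deficient direction matrix carry no meaning. *)
Definition cCG_state (X0 : 'M[F]_(n, p)) (k : nat) :=
  iter k cCG_step (X0, residual X0).

Definition cCG_X X0 k := (cCG_state X0 k).1.
Definition cCG_R X0 k := residual (cCG_X X0 k).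
Definition cCG_D X0 k := (cCG_state X0 k).2.

Definition cCG_reaches (X0 : 'M[F]_(n, p)) (k : nat) : Prop :=
  forall i : nat, (i < k)%N -> \rank (cCG_D X0 i) = p.

End CooperativeCG.

(* Main.v *)
Require Import Defs.
From mathcomp Require Import all_boot all_order all_algebra reals.
From mathcomp Require Import ring.
Set Implicit Arguments.
Unset Strict Implicit.
Import Order.TTheory GRing.Theory Num.Theory.
Local Open Scope ring_scope.

(** Because [A] is positive definite, [D_i^T A D_i] is invertible as soon as
   [D_i] has full rank, so that [alpha_i] and [beta_i] do what they are designed
   for: [alpha_i] makes the new residual orthogonal to [D_i], and [beta_i] makes
   the new direction [A]-orthogonal to [D_i] ([D_tr_R_succ], [D_trA_D_succ]).
   What remains is that these two relations with the last direction propagate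
   to all earlier ones, which is an induction on the iteration ([cCG_orth]).
   For the residuals this follows at once from [R_{m+1} = R_m + A D_m alpha_m^T]
   and from the [A]-orthogonality already known.  For the directions one needs
   [D_i^T A R_{m+1} = 0] with [i < m]; this holds because
   [A D_i alpha_i^T = R_{i+1} - R_i], both terms are orthogonal to [R_{m+1}], and
   the matrix [alpha_i] is invertible ([alphaT_unit]).  This last point is what
   distinguishes the block method from ordinary CG, where [alpha_i] is a nonzero
   scalar.  It comes from [R_i^T D_i = R_i^T R_i], where [R_i] has
   full rank: a vector [v] with [R_i v = 0] gives [D_i v] in the range of
   [D_{i-1}], to which [D_i] is [A]-orthogonal, so that [D_i^T A D_i v = 0].

   The directions being [A]-orthogonal and of full rank, their [(k+1)p] columns
   are linearly independent ([D_block_free]).  The recurrences put these columns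
   in the span of the residuals and in the Krylov space ([D_in_R_span],
   [RD_in_krylov]).  Each of these is generated by [(k+1)p] vectors, so the
   inclusions are equalities by a dimension count ([eq_block_span]).

   Finally, the gradient of the quadratic at a column of [X_{k+1}] is the
   corresponding column of [R_{k+1}], which is orthogonal to all of
   [D_0, ..., D_k]; strict convexity makes such a point the only minimizer
   ([quadratic_minimizer]). *)

(** * Column spaces of block rows *)

Lemma colspanP {F : fieldType} {n q : nat} (M : 'M[F]_(n, q)) (x : 'cV[F]_n) :
  reflect (exists v : 'cV[F]_q, x = M *m v) (x \in colspan M).
Proof.
apply: (iffP memv_imgP) => [[v _ ->] | [v ->]].
  by exists v; rewrite lfunE.
by exists v; rewrite ?memvf // lfunE.
Qed.

Section BlockSpan.

Variables (F : fieldType) (n p : nat).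
Implicit Types (M N : nat -> 'M[F]_(n, p)) (V : {vspace 'cV[F]_n}).

Lemma block_spanP M k (x : 'cV[F]_n) :
  reflect (exists c : 'I_k.+1 -> 'cV[F]_p, x = \sum_(i < k.+1) M i *m c i)
          (x \in block_span M k).
Proof.
apply: (iffP (colspanP _ _)) => [[v ->] | [c ->]].
  by exists (submxcol v); rewrite -{1}[v]submxcolK mul_mxrow_mxcol.
by exists (\mxcol_(i < k.+1) c i); rewrite mul_mxrow_mxcol.
Qed.

Lemma mem_block_span {M k} i (v : 'cV[F]_p) :
  (i <= k)%N -> M i *m v \in block_span M k.
Proof.
move=> le_ik; apply/block_spanP.
exists (fun j => if j == Ordinal (le_ik : (i < k.+1)%N) then v else 0).
rewrite (bigD1 (Ordinal (le_ik : (i < k.+1)%N))) //= eqxx big1 ?addr0 // => j.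
by move/negPf->; rewrite mulmx0.
Qed.

Lemma block_span_subv {M k V} :
  (forall i (v : 'cV[F]_p), (i <= k)%N -> M i *m v \in V) ->
  (block_span M k <= V)%VS.
Proof.
move=> MV; apply/subvP=> x /block_spanP[c ->].
by apply: memv_suml => i _; apply: MV; rewrite -ltnS.
Qed.

Lemma block_span_leq {M k m} :
  (k <= m)%N -> (block_span M k <= block_span M m)%VS.
Proof.
by move=> le_km; apply: block_span_subv => i v /leq_trans/(_ le_km);
  apply: mem_block_span.
Qed.

Lemma dim_block_span_le M k : (\dim (block_span M k) <= k.+1 * p)%N.
Proof.
rewrite (leq_trans (leq_trans (leq_addl _ _) (eq_leq (limg_ker_dim _ _)))) //.
by rewrite dimvf dim_matrix mulr1 sum_nat_const card_ord.
Qed.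

Lemma dim_block_span M k :
  (forall c : 'I_k.+1 -> 'cV[F]_p,
     \sum_(i < k.+1) M i *m c i = 0 -> forall i, c i = 0) ->
  \dim (block_span M k) = (k.+1 * p)%N.
Proof.
move=> M_free; rewrite /block_span /colspan limg_dim_eq.
  by rewrite dimvf dim_matrix mulr1 sum_nat_const card_ord.
apply/eqP; rewrite capfv -subv0; apply/subvP=> v.
rewrite memv_ker lfunE /= memv0 -[v]submxcolK mul_mxrow_mxcol => /eqP/M_free v0.
by under eq_mxcol do rewrite v0; rewrite mxcol0.
Qed.

(** A space spanned by [k.+1 * p] vectors has at most that dimension, so an
   inclusion is enough once the smaller space is known to reach it. *)
Lemma eq_block_span {M N k} :
  \dim (block_span M k) = (k.+1 * p)%N ->
  (forall i (v : 'cV[F]_p), (i <= k)%N -> M i *m v \in block_span N k) ->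
  block_span M k = block_span N k.
Proof.
move=> dimM MN; apply/eqP; rewrite eqEdim dimM dim_block_span_le andbT.
exact: block_span_subv.
Qed.

End BlockSpan.

(** * Positive definite Gram matrices *)

Lemma rank_mulmx_eq0 {F : fieldType} {n p : nat} {M : 'M[F]_(n, p)} :
  \rank M = p -> forall v : 'cV[F]_p, M *m v = 0 -> v = 0.
Proof.
move=> rkM v Mv0; apply: (can_inj trmxK).
apply: (row_free_inj (A := M^T)); first by rewrite /row_free mxrank_tr rkM.
by rewrite -!trmx_mul Mv0 mulmx0.
Qed.

(** If [v] is in the kernel of the Gram matrix, the quadratic form of [A]
   vanishes at [M v], hence [M v = 0]. *)
Lemma posdef_gram_unit {R : realType} {n p : nat} {A : 'M[R]_n} {M : 'M[R]_(n, p)} :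
  posdefmx A -> (forall v : 'cV[R]_p, M *m v = 0 -> v = 0) ->
  M^T *m A *m M \in unitmx.
Proof.
move=> A_pd M_inj; rewrite -row_free_unit; apply: inj_row_free => v vG0.
apply: (can_inj trmxK); rewrite linear0; apply: M_inj.
apply/eqP/negPn/negP=> /A_pd; rewrite trmx_mul trmxK.
have -> : v *m M^T *m A *m (M *m v^T) = v *m (M^T *m A *m M) *m v^T.
  by rewrite !mulmxA.
by rewrite vG0 mul0mx mxE ltxx.
Qed.

Lemma posdefmx1 {R : realType} {n : nat} : posdefmx (1%:M : 'M[R]_n).
Proof.
move=> x x_neq0; rewrite mulmx1 mxE.
have ge0 i : true -> 0 <= x^T 0 i * x i 0 by rewrite mxE -expr2 sqr_ge0.
rewrite lt0r sumr_ge0 // andbT psumr_eq0 //.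
apply: contra x_neq0 => /allP x0; apply/eqP/colP=> i; rewrite mxE.
by have := x0 i (mem_index_enum i); rewrite mxE -expr2 sqrf_eq0 => /eqP.
Qed.

(** * The cCG recurrences *)

Section Recurrences.

Variables (R : realType) (n p : nat) (A : 'M[R]_n) (b : 'cV[R]_n).
Variable X0 : 'M[R]_(n, p).
Hypotheses (A_sym : A^T = A) (A_posdef : posdefmx A).

Local Notation X := (cCG_X A b X0).
Local Notation r := (cCG_R A b X0).
Local Notation D := (cCG_D A b X0).
Local Notation S i := ((D i)^T *m A *m D i).

Lemma trmxA_mul {q s} (M : 'M[R]_(n, q)) (N : 'M[R]_(n, s)) :
  (M^T *m A *m N)^T = N^T *m A *m M.
Proof. by rewrite !trmx_mul trmxK A_sym mulmxA. Qed.

(** [alphaT i] and [betaT i] are the transposes of the coefficient matrices of the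
   algorithm, the form in which they multiply [D i].  Symmetry of [A] allows the
   transpose to be pushed inside the inverse. *)
Definition alphaT i : 'M[R]_p := - (invmx (S i) *m ((D i)^T *m r i)).

Definition betaT i : 'M[R]_p := - (invmx (S i) *m ((D i)^T *m A *m r i.+1)).

Lemma cCG_X_succ i : X i.+1 = X i + D i *m alphaT i.
Proof.
have -> : X i.+1 = X i + D i *m (cCG_alpha A (r i) (D i))^T.
  rewrite /cCG_R /cCG_X /cCG_D /cCG_state /=.
  by case: (iter i _ _).
congr (_ + _ *m _).
rewrite /alphaT /cCG_alpha linearN /= trmx_mul trmx_inv trmxA_mul.
by rewrite trmx_mul trmxK.
Qed.

Lemma cCG_R_succ i : r i.+1 = r i + A *m (D i *m alphaT i).
Proof. by rewrite /cCG_R /residual cCG_X_succ mulmxDr addrAC. Qed.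

Lemma cCG_D_succ i : D i.+1 = r i.+1 + D i *m betaT i.
Proof.
have -> : D i.+1 = r i.+1 + D i *m (cCG_beta A (r i.+1) (D i))^T.
  rewrite /cCG_R /cCG_X /cCG_D /cCG_state /=.
  by case: (iter i _ _).
congr (_ + _ *m _).
by rewrite /betaT /cCG_beta linearN /= trmx_mul trmx_inv trmxA_mul trmxA_mul.
Qed.

Lemma cCG_D0 : D 0 = r 0. Proof. by []. Qed.

Lemma cCG_R_pred i : r i.+1 = D i.+1 - D i *m betaT i.
Proof. by rewrite cCG_D_succ addrK. Qed.

Lemma gramS_unit {i} : \rank (D i) = p -> S i \in unitmx.
Proof. by move=> rkD; apply: posdef_gram_unit (rank_mulmx_eq0 rkD). Qed.

Lemma D_tr_R_succ {i} : \rank (D i) = p -> (D i)^T *m r i.+1 = 0.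
Proof.
move=> rkD; rewrite cCG_R_succ /alphaT !mulmxN mulmxDr mulmxN !mulmxA mulmxV.
  by rewrite mul1mx subrr.
exact: gramS_unit.
Qed.

Lemma D_trA_D_succ {i} : \rank (D i) = p -> (D i)^T *m A *m D i.+1 = 0.
Proof.
move=> rkD; rewrite cCG_D_succ /betaT mulmxN mulmxDr mulmxN !mulmxA mulmxV.
  by rewrite mul1mx subrr.
exact: gramS_unit.
Qed.

(** Each residual is a combination of the directions up to its own index, by
   the direction recurrence read backwards. *)
Lemma R_tr_eq0 {q} (N : 'M[R]_(n, q)) m :
  (forall i, (i <= m)%N -> (D i)^T *m N = 0) ->
  forall i, (i <= m)%N -> (r i)^T *m N = 0.
Proof.
move=> DN [|i] le_im; first by rewrite -cCG_D0 DN.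
by rewrite cCG_R_pred linearB /= trmx_mul mulmxBl -mulmxA !DN ?mulmx0 ?subr0 // ltnW.
Qed.

(** Orthogonality to the previous direction alone turns [D_i^T R_i] into the Gram
   matrix of [R_i], and makes [R_i] injective.  The condition [j.+1 = i] covers
   the case [i = 0], which has no previous direction. *)
Lemma alphaT_unit {i} :
  \rank (D i) = p ->
  (forall j, j.+1 = i -> (D j)^T *m A *m D i = 0 /\ (D j)^T *m r i = 0) ->
  alphaT i \in unitmx.
Proof.
move=> rkD orth.
have DR : (D i)^T *m r i = (r i)^T *m 1%:M *m r i.
  case: i {rkD} orth => [|i] orth; first by rewrite mulmx1 cCG_D0.
  rewrite mulmx1 {1}cCG_D_succ [(_ + _)^T]linearD /= mulmxDl trmx_mul -mulmxA.
  by have [_ ->] := orth i erefl; rewrite mulmx0 addr0.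
have R_inj : forall v : 'cV[R]_p, r i *m v = 0 -> v = 0.
  case: i rkD {DR} orth => [|i] rkD orth v rv0.
    by apply: (rank_mulmx_eq0 rkD); rewrite cCG_D0.
  have [DAD _] := orth i erefl.
  have Dv : D i.+1 *m v = D i *m betaT i *m v.
    by apply/eqP; rewrite -subr_eq0 -mulmxBl -cCG_R_pred rv0.
  suff Sv0 : S i.+1 *m v = 0.
    by rewrite -[v](mulKmx (gramS_unit rkD)) Sv0 mulmx0.
  have DAD' : (D i.+1)^T *m A *m D i = 0 by rewrite -trmxA_mul DAD linear0.
  by rewrite -mulmxA Dv !mulmxA DAD' !mul0mx.
rewrite /alphaT -mulmxN unitmx_mul unitmx_inv gramS_unit //=.
rewrite -scaleN1r unitmxZ ?unitrN1 // DR.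
exact: posdef_gram_unit posdefmx1 R_inj.
Qed.

(** Both orthogonality relations have to be carried by one induction.  Only the
   directions before [m] are assumed to be of full rank, so the result applies to
   the residual computed from the last full rank direction, as minimality
   of [X_{k+1}] demands. *)
Lemma cCG_orth m :
  cCG_reaches A b X0 m ->
  forall i j, (i < j <= m)%N ->
    (D i)^T *m r j = 0 /\ (D i)^T *m A *m D j = 0.
Proof.
elim: m => [|m IH] reach i j; first by case: j => [|j]; rewrite ?ltn0 ?andbF.
have {}IH := IH (fun l lt_lm => reach l (leqW lt_lm)).
case/andP=> lt_ij; rewrite leq_eqVlt => /predU1P[Ej | lt_jm]; last first.
  by apply: IH; rewrite lt_ij.
subst j; have Dr l : (l <= m)%N -> (D l)^T *m r m.+1 = 0.
  rewrite leq_eqVlt => /predU1P[-> | lt_lm]; first by apply/D_tr_R_succ/reach.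
  have [Dlr DlD] : _ := IH l m (introT andP (conj lt_lm (leqnn m))).
  by rewrite cCG_R_succ mulmxDr Dlr !mulmxA DlD mul0mx add0r.
split; first exact: Dr.
move: lt_ij; rewrite ltnS leq_eqVlt => /predU1P[-> | lt_im].
  by apply/D_trA_D_succ/reach.
(* Here [i.+1 <= m], so the residuals [r i] and [r i.+1] both precede
   [r m.+1]; solving the residual recurrence for [A D_i] uses the inverse of
   [alphaT i]. *)
have alpha_i : alphaT i \in unitmx.
  apply: alphaT_unit; first by apply: reach; rewrite ltnW.
  move=> j Ej; have [|Djr DjD] := IH j i; last by split.
  by rewrite -{1}Ej leqnn ltnW.
have rr := R_tr_eq0 Dr.
have ADi : A *m D i = (r i.+1 - r i) *m invmx (alphaT i).
  by rewrite cCG_R_succ addrC addKr mulmxA mulmxK.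
have DAr : (D i)^T *m A *m r m.+1 = 0.
  rewrite -[(D i)^T *m A]trmxK trmx_mul A_sym trmxK ADi trmx_mul -mulmxA.
  by rewrite [(_ - _)^T]linearB /= mulmxBl !rr ?subr0 ?mulmx0 // ltnW.
have [_ DAD] := IH i m (introT andP (conj lt_im (leqnn m))).
by rewrite cCG_D_succ mulmxDr DAr mulmxA DAD mul0mx addr0.
Qed.

Lemma D_in_R_span k i (v : 'cV[R]_p) :
  (i <= k)%N -> D i *m v \in block_span r k.
Proof.
elim: i v => [|i IH] v le_ik; first by rewrite cCG_D0 mem_block_span.
by rewrite cCG_D_succ mulmxDl rpredD ?mem_block_span // -mulmxA IH // ltnW.
Qed.

Local Notation krylov_block := (fun i : nat => A ^+ i *m r 0).
Local Notation K := (block_span krylov_block).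

Lemma mulmx_krylov m x : x \in K m -> A *m x \in K m.+1.
Proof.
case/block_spanP=> c ->; rewrite mulmx_sumr; apply: memv_suml => i _.
have -> : A *m (A ^+ i *m r 0 *m c i) = A ^+ i.+1 *m r 0 *m c i.
  by rewrite exprS !mulmxA.
by apply: (mem_block_span (M := krylov_block)); rewrite ltnS -ltnS.
Qed.

(** The two inclusions advance together: [R_{m+1}] uses [A D_m], which costs
   one more power of [A], and [D_{m+1}] uses [R_{m+1}]. *)
Lemma RD_in_krylov m (v : 'cV[R]_p) : r m *m v \in K m /\ D m *m v \in K m.
Proof.
elim: m v => [|m IH] v.
  suff: r 0 *m v \in K 0 by rewrite cCG_D0.
  have := mem_block_span (M := krylov_block) v (leqnn 0).
  by rewrite expr0 mul1mx.
have Km := subvP (block_span_leq (M := krylov_block) (leqnSn m)).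
have rK w : r m.+1 *m w \in K m.+1.
  rewrite cCG_R_succ mulmxDl rpredD ?(Km _ (IH w).1) //.
  by rewrite -!mulmxA mulmx_krylov // (IH _).2.
split=> //; rewrite cCG_D_succ mulmxDl rpredD // -mulmxA.
by apply: Km; rewrite (IH _).2.
Qed.

(** Multiplying a vanishing combination by [D_i^T A] isolates the term of
   index [i], whose coefficient matrix is invertible. *)
Lemma D_block_free k :
  (forall i, (i <= k)%N -> \rank (D i) = p) ->
  (forall i j, (i <= k)%N -> (j <= k)%N -> i <> j -> (D i)^T *m A *m D j = 0) ->
  forall c : 'I_k.+1 -> 'cV[R]_p,
    \sum_(i < k.+1) D i *m c i = 0 -> forall i, c i = 0.
Proof.
move=> rkD orth c sum0 i.
have S_unit : S i \in unitmx by apply/gramS_unit/rkD; rewrite -ltnS.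
rewrite -[c i](mulKmx S_unit).
have : (D i)^T *m A *m (\sum_(j < k.+1) D j *m c j) = 0 by rewrite sum0 mulmx0.
rewrite mulmx_sumr (bigD1 i) //= big1 => [|j neq_ji]; last first.
  rewrite mulmxA orth ?mul0mx // -1?ltnS // => /ord_inj Eij.
  by rewrite Eij eqxx in neq_ji.
by rewrite addr0 mulmxA => ->; rewrite mulmx0.
Qed.

Lemma cCG_X_sub k (v : 'cV[R]_p) : (X k.+1 - X0) *m v \in block_span D k.
Proof.
elim: k v => [|k IH] v.
  by rewrite cCG_X_succ addrAC subrr add0r -mulmxA mem_block_span.
rewrite cCG_X_succ addrAC mulmxDl rpredD //.
  exact: (subvP (block_span_leq (leqnSn k))).
by rewrite -mulmxA mem_block_span.
Qed.

End Recurrences.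

(** * Minimizing the quadratic over an affine subspace *)

Lemma quadraticD {R : realType} {n : nat} {A : 'M[R]_n} {b : 'cV[R]_n} x d :
  A^T = A ->
  quadratic A b (x + d) = quadratic A b x + (d^T *m (A *m x - b)) 0 0
                          + 2^-1 * (d^T *m A *m d) 0 0.
Proof.
move=> A_sym; rewrite /quadratic.
have sc (M : 'M[R]_1) : M 0 0 = M^T 0 0 by rewrite mxE.
have -> : (x + d)^T *m A *m (x + d) =
  x^T *m A *m x + x^T *m A *m d + (d^T *m A *m x + d^T *m A *m d).
  by rewrite [(_ + _)^T]linearD /= !mulmxDl !mulmxDr.
have Exd : (x^T *m A *m d) 0 0 = (d^T *m A *m x) 0 0.
  by rewrite sc !trmx_mul trmxK A_sym mulmxA.
have Ebd : (d^T *m b) 0 0 = (b^T *m d) 0 0 by rewrite sc trmx_mul trmxK.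
have addE (M N : 'M[R]_1) : (M + N) 0 0 = M 0 0 + N 0 0 by rewrite mxE.
have oppE (M : 'M[R]_1) : (- M) 0 0 = - M 0 0 by rewrite mxE.
rewrite mulmxBr mulmxDr mulmxA !(addE, oppE) Exd Ebd.
by field.
Qed.

(** On [x + V] the first order term of the quadratic vanishes, and the second order term is
   positive away from [x]. *)
Lemma quadratic_minimizer {R : realType} {n : nat} {A : 'M[R]_n} {b : 'cV[R]_n}
    (V : {vspace 'cV[R]_n}) (x0 x : 'cV[R]_n) :
  A^T = A -> posdefmx A -> x - x0 \in V ->
  (forall d, d \in V -> d^T *m (A *m x - b) = 0) ->
  unique (minimizer (quadratic A b) (fun y => y - x0 \in V)) x.
Proof.
move=> A_sym A_pd Vx grad0.
have f_y y : y - x0 \in V -> y - x \in V /\ quadratic A b y =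
    quadratic A b x + 2^-1 * ((y - x)^T *m A *m (y - x)) 0 0.
  move=> Vy; have Vd : y - x \in V.
    by rewrite -[y - x](subrKA x0) -(opprB x x0) rpredB.
  split=> //; rewrite -{1}[y](subrKC x) quadraticD // grad0 //.
  by rewrite mxE addr0.
split.
  split=> // y /f_y[_ ->]; rewrite lerDl mulr_ge0 ?invr_ge0 ?ler0n //.
  have [-> | /A_pd/ltW//] := eqVneq (y - x) 0.
  by rewrite mulmx0 mxE.
move=> y [/f_y[_ Ey] y_min]; apply/esym/eqP; rewrite -subr_eq0.
apply/negPn/negP=> /A_pd d_gt0; have := y_min x Vx.
by rewrite Ey gerDl leNgt mulr_gt0 ?invr_gt0 ?ltr0n.
Qed.

Theorem theorem2 (R : realType) (n p : nat) (A : 'M[R]_n) (b : 'cV[R]_n)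
    (X0 : 'M[R]_(n, p)) (k : nat)
    (A_sym : A^T = A) (A_posdef : posdefmx A)
    (p_ge1 : (1 <= p)%N) (p_lt_n : (p < n)%N)
    (k_reached : cCG_reaches A b X0 k)
    (Dk_full : \rank (cCG_D A b X0 k) = p) :
  [/\ forall i j : nat, (i <= k)%N -> (j <= k)%N -> i <> j ->
        (cCG_R A b X0 i)^T *m cCG_R A b X0 j = 0,
      forall i j : nat, (i <= k)%N -> (j <= k)%N -> i <> j ->
        (cCG_D A b X0 i)^T *m A *m cCG_D A b X0 j = 0,
      [/\ block_span (cCG_R A b X0) k = block_span (cCG_D A b X0) k,
          block_span (cCG_D A b X0) k =
            block_span (fun i : nat => A ^+ i *m cCG_R A b X0 0) k &
          \dim (block_span (cCG_D A b X0) k) = (k.+1 * p)%N] &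
      forall j : 'I_p,
        unique
          (minimizer (quadratic A b)
             (fun y : 'cV[R]_n =>
                y - col j X0 \in block_span (cCG_D A b X0) k))
          (col j (cCG_X A b X0 k.+1))].
Proof.
have rkD i : (i <= k)%N -> \rank (cCG_D A b X0 i) = p.
  by rewrite leq_eqVlt => /predU1P[-> // | /k_reached].
have orth := @cCG_orth _ _ _ _ b X0 A_sym A_posdef k.+1 rkD.
have orthD i j : (i <= k)%N -> (j <= k)%N -> i <> j ->
    (cCG_D A b X0 i)^T *m A *m cCG_D A b X0 j = 0.
  move=> le_ik le_jk /eqP; rewrite neq_ltn => /orP[lt_ij | lt_ji].
    by have [|_ ->] := orth i j; rewrite ?lt_ij ?leqW.
  rewrite -[LHS]trmxK trmxA_mul //; have [|_ ->] := orth j i.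
    by rewrite lt_ji leqW.
  by rewrite linear0.
have orthR i j : (i < j)%N -> (j <= k)%N ->
    (cCG_R A b X0 i)^T *m cCG_R A b X0 j = 0.
  case: j => // j lt_ij le_jk.
  apply: (R_tr_eq0 A_sym (m := j)) => // l le_lj.
  by have [|-> _] := orth l j.+1; rewrite ?ltnS ?le_lj 1?ltnW.
have dimD := dim_block_span (D_block_free A_posdef rkD orthD).
split=> //.
- move=> i j le_ik le_jk /eqP; rewrite neq_ltn => /orP[lt_ij | lt_ji].
    exact: orthR.
  by rewrite -[LHS]trmxK trmx_mul trmxK orthR ?linear0.
- split=> //.
    apply/esym/(eq_block_span dimD) => i v.
    exact: D_in_R_span.
  apply: (eq_block_span dimD) => i v le_ik.
  have [_] := RD_in_krylov b X0 A_sym i v.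
  exact: (subvP (block_span_leq (M := fun i => A ^+ i *m cCG_R A b X0 0) le_ik)).
move=> j; apply: quadratic_minimizer => //.
  by rewrite !colE -mulmxBl cCG_X_sub.
move=> d /block_spanP[c ->].
(* The gradient of the quadratic at column [j] is column [j] of the residual. *)
have -> : A *m col j (cCG_X A b X0 k.+1) - b = cCG_R A b X0 k.+1 *m delta_mx j 0.
  rewrite /cCG_R /residual colE mulmxBl mulmxA; congr (_ - _).
  by apply/colP=> i; rewrite -colE !mxE big_ord1 !mxE mulr1.
rewrite linear_sum /= mulmx_suml big1 // => i _.
rewrite trmx_mul !mulmxA -[_ *m _ *m cCG_R _ _ _ _]mulmxA.
by have [|->] := orth i k.+1; rewrite ?leqnn ?andbT // mulmx0 mul0mx.
Qed.
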